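(* Let $G$ be a directed graph with nonnegative arc capacities, a set $S$ of sources and a set $T$ of sinks. Start with the zero flow and perform the following procedure: iterate over the sources $s\in S$ in an arbitrary order; for each source $s$, iterate over the sinks $t\in T$ in an arbitrary order; for each pair $(s,t)$, compute a maximum $s$-to-$t$ flow in the current residual graph and augment the current flow by it (thereby saturating all $s$-to-$t$ residual paths). Then the flow obtained at the end is a maximum flow from $S$ to $T$, i.e.\ no residual path leads from any source to any sink.
   Context: A flow is an assignment of values to arcs, each between $0$ and the arc's capacity, such that for every vertex that is neither a source nor a sink the total flow entering equals the total flow leaving. The residual graph of a flow contains an arc $(u,v)$ if $(u,v)$ carries flow less than its capacity and the reverse arc $(v,u)$ if $(u,v)$ carries positive flow. A flow from $S$ to $T$ is maximum if it maximizes the amount of flow leaving $S$, equivalently if there is no residual path from a vertex of $S$ to a vertex of $T$. *)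

(* Defs.v *)
From mathcomp Require Import all_boot all_order all_algebra.

Set Implicit Arguments.
Unset Strict Implicit.
Unset Printing Implicit Defensive.

Import Order.TTheory GRing.Theory Num.Theory.
Local Open Scope ring_scope.

(* Arcs form a type of their own, so parallel arcs, antiparallel arcs and loops
   are allowed; a residual graph may have parallel arcs even when the graph it
   comes from has none. *)
Record network (R : realFieldType) (V : finType) := Network {
  arcs : finType;
  src : arcs -> V;
  tgt : arcs -> V;
  capacity : arcs -> R
}.

Section Flows.

Variables (R : realFieldType) (V : finType).
Implicit Types (G : network R V) (S T : {set V}).

Definition is_flow G S T (f : {ffun arcs G -> R}) : Prop :=
  (forall a, 0 <= f a <= capacity a) /\
  (forall v, v \notin S -> v \notin T ->
     \sum_(a | tgt a == v) f a = \sum_(a | src a == v) f a).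

(* Net amount: for the gross amount, a circulation through S would count. *)
Definition flow_value G S (f : {ffun arcs G -> R}) : R :=
  \sum_(a | src a \in S) f a - \sum_(a | tgt a \in S) f a.

Definition is_max_flow G S T (f : {ffun arcs G -> R}) : Prop :=
  is_flow S T f /\
  forall g : {ffun arcs G -> R}, is_flow S T g ->
    flow_value S g <= flow_value S f.

Definition residual_rel G (f : {ffun arcs G -> R}) : rel V :=
  [rel u v | [exists a : arcs G,
     [&& src a == u, tgt a == v & f a < capacity a]
     || [&& tgt a == u, src a == v & 0 < f a]]].

Definition residual_path G (f : {ffun arcs G -> R}) (u v : V) : bool :=
  connect (residual_rel f) u v.

(* [inl a] is the arc a itself and [inr a] its reverse. Arcs absent from the
   residual graph are kept with capacity 0, so every flow vanishes on them. *)
Definition residual G (f : {ffun arcs G -> R}) : network R V := {|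
  arcs := (arcs G + arcs G)%type;
  src := fun b => match b with inl a => src a | inr a => tgt a end;
  tgt := fun b => match b with inl a => tgt a | inr a => src a end;
  capacity := fun b => match b with inl a => capacity a - f a | inr a => f a end
|}.

Definition augment G (f : {ffun arcs G -> R}) (g : {ffun arcs (residual f) -> R})
    : {ffun arcs G -> R} :=
  [ffun a => f a + g (inl a) - g (inr a)].

Definition saturate_pair G (s t : V) (f f' : {ffun arcs G -> R}) : Prop :=
  exists2 g : {ffun arcs (residual f) -> R},
    is_max_flow [set s] [set t] g & f' = augment g.

End Flows.

Section Loops.

Variables (V : finType) (state : Type).

Fixpoint run_seq (step : V -> state -> state -> Prop) (r : seq V)
    (x y : state) : Prop :=
  match r with
  | [::] => y = x
  | v :: r' => exists2 z, step v x z & run_seq step r' z y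
  end.

(* y is a possible outcome of running step once for each element of A, in some
   order, starting from x. *)
Definition for_each (A : {set V}) (step : V -> state -> state -> Prop)
    (x y : state) : Prop :=
  exists2 r : seq V, perm_eq r (enum A) & run_seq step r x y.

End Loops.

(* The order of the sinks may differ from one source to the next. *)
Definition saturation_outcome (R : realFieldType) (V : finType)
    (G : network R V) (S T : {set V}) (f : {ffun arcs G -> R}) : Prop :=
  for_each S
    (fun s => for_each T (fun t => @saturate_pair R V G s t))
    [ffun=> 0] f.

(* Main.v *)
Require Import Defs.
From mathcomp Require Import all_boot all_order all_algebra.
From mathcomp Require Import lra.

(* Call a vertex set X closed when no residual arc leaves it, and let s and t be
   the pair being saturated. A residual s-t flow has nonnegative value, so unless
   t lies in X and s does not, its net flow out of X is nonnegative; as no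
   residual arc leaves X, it then vanishes on every arc crossing X, and X stays
   closed. Applied to the set reachable from a source s', this shows that
   separations survive: the exceptional case does not occur for s' = s, nor for
   an s' already separated from all of T. At the end, the set reachable from S
   is a saturated cut. *)

Set Implicit Arguments.
Unset Strict Implicit.
Unset Printing Implicit Defensive.

Import Order.TTheory GRing.Theory Num.Theory.
Local Open Scope ring_scope.

Section Flows.

Variables (R : realFieldType) (V : finType).
Implicit Types (G : network R V) (S T X : {set V}) (s t u v : V).

(** * Net flow out of a vertex set *)

Lemma flow_valueE G X (f : {ffun arcs G -> R}) :
  flow_value X f = \sum_a f a * ((src a \in X)%:R - (tgt a \in X)%:R).
Proof.
rewrite /flow_value [X in X - _]big_mkcond [X in _ - X]big_mkcond -sumrB.
by apply: eq_bigr => a _; case: (src a \in X); case: (tgt a \in X) => /=; lra.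
Qed.

Lemma flow_value_setE G X (f : {ffun arcs G -> R}) :
  flow_value X f = \sum_(v in X) flow_value [set v] f.
Proof.
under eq_bigr do rewrite flow_valueE.
rewrite exchange_big flow_valueE; apply: eq_bigr => a _.
have sum_ind u : \sum_(v in X) (u \in [set v])%:R = (u \in X)%:R :> R.
  rewrite big_mkcond (bigD1 u) //= set11 big1 ?addr0; first by case: ifP.
  by move=> v neq_vu; rewrite inE eq_sym (negbTE neq_vu) if_same.
by rewrite -mulr_sumr sumrB !sum_ind.
Qed.

Lemma flow_value_setT G (f : {ffun arcs G -> R}) : flow_value setT f = 0.
Proof. by rewrite flow_valueE big1 // => a _; rewrite !inE subrr mulr0. Qed.

Lemma conserved_flow_value G v (f : {ffun arcs G -> R}) :
  flow_value [set v] f = 0 <->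
  \sum_(a | tgt a == v) f a = \sum_(a | src a == v) f a.
Proof.
rewrite /flow_value.
under eq_bigl do rewrite inE; under [X in _ - X]eq_bigl do rewrite inE.
by split=> [/eqP|->]; rewrite ?subrr // subr_eq0 => /eqP.
Qed.

(** Conservation leaves only [s] and [t] to contribute to the net flow out of a set; over the whole
    vertex set these two contributions cancel, so that of [t] is minus that of [s]. *)
Lemma st_flow_value G s t X (g : {ffun arcs G -> R}) :
  s != t -> is_flow [set s] [set t] g ->
  flow_value X g = ((s \in X)%:R - (t \in X)%:R) * flow_value [set s] g.
Proof.
move=> neq_st [_ cons].
have value_split Y : flow_value Y g =
    (s \in Y)%:R * flow_value [set s] g + (t \in Y)%:R * flow_value [set t] g.
  rewrite flow_value_setE big_mkcond (bigD1 s) //= (bigD1 t) 1?eq_sym //=.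
  rewrite big1 ?addr0.
    by case: (s \in Y); case: (t \in Y); rewrite ?mul1r ?mul0r.
  move=> v /andP[neq_vs neq_vt]; case: ifP => // _.
  by apply/conserved_flow_value/cons; rewrite inE.
have := flow_value_setT g; rewrite value_split !inE !mul1r.
by rewrite addrC => /eqP; rewrite addr_eq0 => /eqP valt; rewrite value_split valt; lra.
Qed.

(** * Residual arcs and closed sets *)

Definition residual_closed G (f : {ffun arcs G -> R}) X :=
  forall b : arcs (residual f),
    src b \in X -> 0 < capacity b -> tgt b \in X.

Lemma residual_relP G (f : {ffun arcs G -> R}) u v :
  reflect (exists b : arcs (residual f),
             [/\ src b = u, tgt b = v & 0 < capacity b])
          (residual_rel f u v).
Proof.
apply: (iffP existsP) => [[a /orP[]/and3P[/eqP su /eqP tv lt]]|].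
- by exists (inl a); rewrite /= subr_gt0.
- by exists (inr a).
case=> -[] a /= [su tv lt]; exists a; rewrite su tv !eqxx /=.
- by rewrite -subr_gt0 lt.
- by rewrite lt orbT.
Qed.

Lemma residual_closed_reach G (f : {ffun arcs G -> R}) S :
  residual_closed f [set v | [exists s in S, residual_path f s v]].
Proof.
move=> b; rewrite !inE => /exists_inP[s sS path_s] lt.
apply/exists_inP; exists s => //; apply: connect_trans path_s _.
by apply: connect1; apply/residual_relP; exists b.
Qed.

Lemma residual_closed_path G (f : {ffun arcs G -> R}) X u v :
  residual_closed f X -> residual_path f u v -> u \in X -> v \in X.
Proof.
move=> closedX /connectP[p]; elim: p u => [|w p IHp] u /=; first by move=> _ ->.
case/andP=> /residual_relP[b [su tw lt]] pth last_p uX.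
by apply: (IHp w) => //; rewrite -tw; apply: closedX; rewrite // su.
Qed.

(** * Effect of an augmentation *)

Lemma augment_flow_value G (f : {ffun arcs G -> R})
    (g : {ffun arcs (residual f) -> R}) X :
  flow_value X (augment g) = flow_value X f + flow_value X g.
Proof.
(* The ends of [inr a] are those of [inl a] swapped, so the two terms combine into
   [g (inl a) - g (inr a)] carried by [a]. *)
rewrite !flow_valueE big_sumType /= -!big_split; apply: eq_bigr => a _ /=.
by rewrite ffunE; lra.
Qed.

Lemma augment_is_flow G S T s t (f : {ffun arcs G -> R})
    (g : {ffun arcs (residual f) -> R}) :
  s \in S -> t \in T -> is_flow S T f -> is_flow [set s] [set t] g ->
  is_flow S T (augment g).
Proof.
move=> sS tT [_ consf] [bg consg]; split=> [a|v vS vT].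
  have /andP[? ?] := bg (inl a); have /andP[? ?] := bg (inr a).
  by rewrite ffunE; apply/andP; split; simpl in *; lra.
apply/conserved_flow_value; rewrite augment_flow_value.
have /conserved_flow_value-> := consf v vS vT.
have /conserved_flow_value-> : \sum_(b | tgt b == v) g b = \sum_(b | src b == v) g b.
  by apply: consg; rewrite inE; [apply: contraNneq vS|apply: contraNneq vT] => ->.
by rewrite addr0.
Qed.

Lemma augment_residual_closed G s t (f : {ffun arcs G -> R})
    (g : {ffun arcs (residual f) -> R}) X :
  is_flow [set s] [set t] g -> 0 <= flow_value [set s] g -> s != t ->
  (t \in X -> s \in X) -> residual_closed f X ->
  residual_closed (augment g) X.
Proof.
move=> flow_g val_ge0 neq_st st_X closedX; have [bg _] := flow_g.
have cross0 b : src b \in X != (tgt b \in X) -> g b = 0.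
  (* An arc leaving [X] has no residual capacity and so carries nothing; an arc entering [X] counts
     negatively. *)
  have term_le0 c : g c * ((src c \in X)%:R - (tgt c \in X)%:R) <= 0.
    have /andP[g_ge0 g_le] := bg c; have := @closedX c.
    case: (src c \in X); case: (tgt c \in X) => //= cl; try lra.
    have : capacity c <= 0 by rewrite leNgt; apply/negP => /(cl isT).
    by lra.
  have valX_ge0 : 0 <= flow_value X g.
    rewrite (st_flow_value _ neq_st flow_g) mulr_ge0 // subr_ge0 ler_nat.
    by case: (t \in X) st_X => // ->.
  have sum0 : \sum_c - (g c * ((src c \in X)%:R - (tgt c \in X)%:R)) = 0.
    apply/eqP; rewrite eq_le sumr_ge0 => [|c _]; last by rewrite oppr_ge0.
    by rewrite sumrN oppr_le0 -flow_valueE valX_ge0.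
  have /psumr_eq0P/(_ sum0)/(_ b isT) : forall c, true ->
      0 <= - (g c * ((src c \in X)%:R - (tgt c \in X)%:R)).
    by move=> c _; rewrite oppr_ge0.
  by case: (src b \in X); case: (tgt b \in X) => //= ? _; lra.
(* [augment g] agrees with [f] on arcs crossing [X], so a residual arc leaving [X] now would already
   have left it under [f]. *)
case=> a /= src_in; rewrite ffunE; apply: contraTT => tgt_out.
all: have gl : g (inl a) = 0 by apply: cross0; rewrite /= src_in (negbTE tgt_out).
all: have gr : g (inr a) = 0 by apply: cross0; rewrite /= src_in (negbTE tgt_out).
all: rewrite gl gr addr0 subr0; apply: contra tgt_out.
- exact: (@closedX (inl a)).
- exact: (@closedX (inr a)).
Qed.

(** * Maximum flows and residual paths *)

(* A residual path need not be simple: summing the contributions of its arcs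
   keeps the signs compatible with the residual capacities. *)
Lemma residual_path_direction G (g : {ffun arcs G -> R}) s t :
  residual_path g s t ->
  exists d : {ffun arcs G -> R},
    [/\ forall X, flow_value X d = (s \in X)%:R - (t \in X)%:R,
        forall a, 0 < d a -> g a < capacity a
      & forall a, d a < 0 -> 0 < g a].
Proof.
case/connectP=> p; elim: p s => [|w p IHp] s /=.
  move=> _ ->; exists [ffun=> 0]; split=> [X|a|a]; rewrite ?ffunE ?ltxx //.
  by rewrite flow_valueE subrr big1 // => a _; rewrite ffunE mul0r.
case/andP=> /residual_relP[b [src_b tgt_b cap_b]] pth last_p.
have [d [val_d pos_d neg_d]] := IHp w pth last_p.
(* The first arc of the path adds one signed unit on its underlying arc of [G]. *)
pose a0 := match b with inl a => a | inr a => a end.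
pose e : R := match b with inl _ => 1 | inr _ => - 1 end.
exists [ffun a => d a + (if a == a0 then e else 0)]; split=> [X|a|a].
- rewrite flow_valueE; under eq_bigr do rewrite ffunE mulrDl.
  rewrite big_split /= -flow_valueE val_d (bigD1 a0) //= eqxx big1 => [|a].
    rewrite addr0 -src_b -tgt_b /e /a0; case: b {src_b tgt_b cap_b a0 e} => a /=.
      by lra.
    by lra.
  by move=> /negbTE->; rewrite mul0r.
- rewrite ffunE; have := pos_d a; case: eqP => [->|_]; last by rewrite addr0.
  (* If [b] runs along [a0], its own positive capacity is the required slack; if it runs backwards,
     [d] was already positive there. *)
  rewrite /a0 /e; case: b cap_b {src_b tgt_b a0 e} => c /= cap_c pos; first by lra.
  by move=> ?; apply: pos; lra.
- rewrite ffunE; have := neg_d a; case: eqP => [->|_]; last by rewrite addr0.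
  rewrite /a0 /e; case: b cap_b {src_b tgt_b a0 e} => c /= cap_c neg; last by [].
  by move=> ?; apply: neg; lra.
Qed.

Lemma feasible_step G (g d : {ffun arcs G -> R}) :
  (forall a, 0 <= g a <= capacity a) ->
  (forall a, 0 < d a -> g a < capacity a) -> (forall a, d a < 0 -> 0 < g a) ->
  exists2 e, 0 < e & forall a, 0 <= g a + e * d a <= capacity a.
Proof.
move=> bg pos_d neg_d.
pose slack a := if 0 < d a then (capacity a - g a) / d a
                else if d a < 0 then g a / - d a else 1.
have slack_gt0 a : 0 < slack a.
  rewrite /slack; case: ifP => [d_gt0|_]; first by rewrite divr_gt0 ?subr_gt0 ?pos_d.
  by case: ifP => // d_lt0; rewrite divr_gt0 ?oppr_gt0 ?neg_d.
(* The default 1 keeps [e] positive even when [G] has no arcs. *)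
pose e := \big[Num.min/1]_a slack a.
have e_gt0 : 0 < e.
  by apply: (big_ind (fun x => 0 < x)) => // x y x0 y0; rewrite lt_min x0.
exists e => // a; have /andP[g_ge0 g_le] := bg a.
have : e <= slack a by exact: bigmin_le_cond.
rewrite /slack; case: ltgtP => [d_gt0|d_lt0|<- _].
- rewrite ler_pdivlMr // => ?; have ? : 0 <= e * d a by rewrite mulr_ge0 ?ltW.
  by lra.
- rewrite ler_pdivlMr ?oppr_gt0 // => ?.
  have ? : e * d a <= 0 by rewrite mulr_ge0_le0 ?ltW.
  by lra.
- by rewrite mulr0 addr0 g_ge0.
Qed.

(** Moving [g] by a small [e] along the direction of a residual path would keep it a flow and raise
    its value by [e]. *)
Lemma max_flow_no_residual_path G s t (g : {ffun arcs G -> R}) :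
  s != t -> is_max_flow [set s] [set t] g -> ~~ residual_path g s t.
Proof.
move=> neq_st [[bg cons] gmax]; apply/negP.
case/residual_path_direction=> d [val_d pos_d neg_d].
have [e e_gt0 be] := feasible_step bg pos_d neg_d.
pose h : {ffun arcs G -> R} := [ffun a => g a + e * d a].
have val_h X : flow_value X h = flow_value X g + e * ((s \in X)%:R - (t \in X)%:R).
  rewrite -val_d !flow_valueE mulr_sumr -big_split; apply: eq_bigr => a _.
  by rewrite ffunE mulrDl mulrA.
have flow_h : is_flow [set s] [set t] h.
  split=> [a|v vs vt]; first by rewrite ffunE.
  have /conserved_flow_value val_g := cons v vs vt.
  apply/conserved_flow_value; rewrite val_h val_g.
  move: vs vt; rewrite !inE ![v == _]eq_sym => /negbTE-> /negbTE->.
  by rewrite subrr mulr0 addr0.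
have := gmax h flow_h; rewrite val_h !inE eqxx [t == s]eq_sym (negbTE neq_st) /=.
by lra.
Qed.

(** Room left on [a] after augmenting means that [g] can still grow on [inl a] or be cancelled on
    [inr a]; positive flow is symmetric. Residual paths thus pass to [g], where maximality
    applies. *)
Lemma augment_residual_rel G (f : {ffun arcs G -> R})
    (g : {ffun arcs (residual f) -> R}) u v :
  residual_rel (augment g) u v -> residual_rel g u v.
Proof.
case/existsP=> a; rewrite ffunE => /orP[]/and3P[su tv lt]; apply/existsP.
- have [|gr_le0] := ltP 0 (g (inr a)) => [gr_gt0|].
    by exists (inr a); rewrite /= su tv gr_gt0 orbT.
  by exists (inl a); rewrite /= su tv /=; apply/orP; left; lra.
- have [|gl_le0] := ltP 0 (g (inl a)) => [gl_gt0|].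
    by exists (inl a); rewrite /= su tv gl_gt0 orbT.
  by exists (inr a); rewrite /= su tv /=; apply/orP; left; lra.
Qed.

Lemma residual_closed_max_flow G S T X (f : {ffun arcs G -> R}) :
  is_flow S T f -> residual_closed f X -> S \subset X -> [disjoint X & T] ->
  is_max_flow S T f.
Proof.
move=> flow_f closedX SX XT; split=> // g flow_g.
(* Vertices of [X] outside [S] are not sinks, so they conserve flow and both sets give the same
   value. *)
have val_cut (h : {ffun arcs G -> R}) : is_flow S T h -> flow_value S h = flow_value X h.
  case=> _ cons; rewrite !flow_value_setE [RHS](big_setID S) /= (setIidPr SX).
  rewrite [X in _ + X]big1 ?addr0 // => v; rewrite inE => /andP[vS vX].
  by apply/conserved_flow_value/cons; rewrite ?(disjointFr XT vX).
rewrite !val_cut // !flow_valueE; apply: ler_sum => a _.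
have [[/(_ a)/andP[f0 fc] _] [/(_ a)/andP[g0 gc] _]] := (flow_f, flow_g).
(* [inl a] shows that [f] saturates the arcs leaving [X], and [inr a] that it vanishes on those
   entering. *)
have := closedX (inl a); have := closedX (inr a) => /=.
by case: (src a \in X); case: (tgt a \in X) => //= clr cll; lra.
Qed.

End Flows.

(** * Saturating one pair *)

Section Saturation.

Variables (R : realFieldType) (V : finType) (G : network R V).
Variables (S T : {set V}).
Hypothesis disjST : [disjoint S & T].
Implicit Types (s t : V) (f : {ffun arcs G -> R}).

Definition separated s f := forall t, t \in T -> ~~ residual_path f s t.

Lemma saturate_pairP s t f f' :
  s \in S -> t \in T -> is_flow S T f -> saturate_pair s t f f' ->
  [/\ is_flow S T f',
      ~~ residual_path f' s t,
      forall v, ~~ residual_path f s v -> ~~ residual_path f' s v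
    & forall u, separated u f -> separated u f'].
Proof.
move=> sS tT flow_f [g max_g ->]; have [flow_g gmax] := max_g.
have neq_st : s != t by apply: contraTneq tT => <-; rewrite (disjointFr disjST).
(* The zero flow competes with [g]. *)
have val_ge0 : 0 <= flow_value [set s] g.
  have <- : flow_value [set s] ([ffun=> 0] : {ffun arcs (residual f) -> R}) = 0.
    by rewrite flow_valueE big1 // => b _; rewrite ffunE mul0r.
  apply: gmax; split=> [b|v _ _]; last by rewrite !big1 // => b _; rewrite ffunE.
  by rewrite ffunE lexx /=; case: flow_g => /(_ b)/andP[g_ge0 g_le] _; exact: le_trans g_le.
(* The premise rules out the one bad position of the set reachable from [u]: containing [t] but not
   [s]. *)
have keep u v : (residual_path f u t -> residual_path f u s) ->
    ~~ residual_path f u v -> ~~ residual_path (augment g) u v.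
  move=> st_u; apply: contra => path_uv.
  pose X := [set w | [exists x in [set u], residual_path f x w]].
  have inX w : (w \in X) = residual_path f u w.
    rewrite inE; apply/exists_inP/idP => [[x]|]; first by rewrite inE => /eqP->.
    by exists u; rewrite ?set11.
  have closedX : residual_closed (augment g) X.
    apply: (augment_residual_closed flow_g) => //; first by rewrite !inX.
    exact: residual_closed_reach.
  rewrite -inX; apply: (residual_closed_path closedX path_uv).
  by rewrite inX; apply: connect0.
split.
- exact: augment_is_flow flow_g.
- apply: contra (max_flow_no_residual_path neq_st max_g).
  by apply: connect_sub => u v /augment_residual_rel; apply: connect1.
- by move=> v; apply: keep => _; apply: connect0.
- move=> u sep_u v vT; apply: keep (sep_u v vT) => path_ut.
  by have := sep_u t tT; rewrite path_ut.
Qed.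

End Saturation.

(** [P] is the loop invariant; [Q v] is gained when [v] is processed and survives every later
    step. *)
Lemma for_each_inv (V : finType) (state : Type) (A : {set V})
    (step : V -> state -> state -> Prop) (P : state -> Prop)
    (Q : V -> state -> Prop) x y :
  (forall v x y, v \in A -> step v x y -> P x ->
     [/\ P y, Q v y & forall w, Q w x -> Q w y]) ->
  for_each A step x y -> P x -> P y /\ forall v, v \in A -> Q v y.
Proof.
move=> stepP [r perm_r run_r] Px.
suff [Py Qy _] : [/\ P y, forall v, v \in r -> Q v y & forall w, Q w x -> Q w y].
  by split=> // v vA; apply: Qy; rewrite (perm_mem perm_r) mem_enum.
have: {subset r <= A} by move=> v; rewrite (perm_mem perm_r) mem_enum.
elim: r x Px run_r {perm_r} => [|v r IHr] x Px /=; first by move=> ->.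
case=> z step_z run_r subA.
have [Pz Qz keepz] := stepP v x z (subA v (mem_head v r)) step_z Px.
have [|Py Qy keepy] := IHr z Pz run_r.
  by move=> w wr; apply: subA; rewrite inE wr orbT.
split=> // [w|w Qw]; last by apply/keepy/keepz.
by rewrite inE => /predU1P[->|/Qy //]; apply: keepy.
Qed.

Theorem theorem3 (R : realFieldType) (V : finType) (G : network R V)
    (S T : {set V}) (f : {ffun arcs G -> R}) :
  (forall a : arcs G, 0 <= capacity a) ->
  [disjoint S & T] ->
  saturation_outcome S T f ->
  is_max_flow S T f /\
  (forall s t : V, s \in S -> t \in T -> ~~ residual_path f s t).
Proof.
move=> cap_ge0 disjST outcome.
have flow0 : is_flow S T ([ffun=> 0] : {ffun arcs G -> R}).
  split=> [a|v _ _]; first by rewrite ffunE lexx cap_ge0.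
  by rewrite !big1 // => a _; rewrite ffunE.
have [flow_f sep_f] : is_flow S T f /\ forall s, s \in S -> separated T s f.
  apply: (for_each_inv (Q := fun s k => separated T s k) _ outcome flow0) => s h k sS inner flow_h.
  have [flow_k sep_k] : is_flow S T k /\
      forall t, t \in T -> ~~ residual_path k s t.
    apply: (for_each_inv (Q := fun t h1 => ~~ residual_path h1 s t) _ inner flow_h) => t h1 h2 tT sat flow_h1.
    by have [? ? ? _] := saturate_pairP disjST sS tT flow_h1 sat; split.
  split=> // u sep_u.
  (* The inner loop is traversed again, now with the separation of an arbitrary [u] from all of [T]
     as part of the invariant; [Q] is then trivial. *)
  pose P (h1 : {ffun arcs G -> R}) := is_flow S T h1 /\ separated T u h1.
  suff [[]] : P k /\ forall t, t \in T -> True by [].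
  apply: (for_each_inv (Q := fun _ _ => True) _ inner (conj flow_h sep_u)).
  move=> t h1 h2 tT sat [flow_h1 sep_h1].
  have [flow_h2 _ _ keep_sep] := saturate_pairP disjST sS tT flow_h1 sat.
  by split=> //; split=> //; apply: keep_sep.
split; last by move=> s t sS; apply: sep_f.
apply: (residual_closed_max_flow flow_f (@residual_closed_reach _ _ _ f S)).
  apply/subsetP => s sS; rewrite inE; apply/exists_inP; exists s => //.
  exact: connect0.
apply/pred0P => t /=; apply/negP => /andP[]; rewrite inE.
by case/exists_inP=> s sS path_st /(sep_f s sS); rewrite path_st.
Qed.
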